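(* Let $\varkappa\geq 2$ be an integer. Let $\{a_n\}_{n=0}^\infty$ be a Stieltjes moment sequence with a representing measure $\mu$, and suppose that $\{\sqrt[\varkappa]{a_n}\}_{n=0}^\infty$ is a Stieltjes moment sequence with a representing measure $\nu$. Suppose that $\nu((\alpha,\beta))=0$ for some $\alpha,\beta\in\mathbb{R}$ such that $0\leq\alpha<\beta\leq\gamma:=\sup\operatorname{supp}\nu<\infty$ and $\alpha\gamma^{\varkappa-1}<\beta^\varkappa$. Set $\vartheta_1:=\alpha\gamma^{\varkappa-1}$, $\vartheta_2:=\beta^\varkappa$ and $\vartheta_3:=\gamma^\varkappa$. Then: (i) $\mu((\vartheta_1,\vartheta_2))=0$ and $\vartheta_3=\sup\operatorname{supp}\mu<\infty$; (ii) $\alpha\in\operatorname{supp}\nu$ if and only if $\vartheta_1\in\operatorname{supp}\mu$; (iii) $\beta\in\operatorname{supp}\nu$ if and only if $\vartheta_2\in\operatorname{supp}\mu$.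
   Context: $\mathbb{R}_+=[0,\infty)$. A sequence $\{a_n\}_{n=0}^\infty\subseteq\mathbb{R}_+$ is a Stieltjes moment sequence if there is a positive Borel measure $\mu$ on $\mathbb{R}_+$ with $a_n=\int_{\mathbb{R}_+}x^n\,d\mu(x)$ for all integers $n\geq 0$ (with $x^0=1$); such $\mu$ is called a representing measure of $\{a_n\}_{n=0}^\infty$. $\operatorname{supp}$ denotes the closed support of a measure. *)

(* Defs.v *)
From HB Require Import structures.
From mathcomp Require Import all_boot all_order all_algebra.
From mathcomp Require Import all_classical all_reals all_analysis.
Set Implicit Arguments.
Unset Strict Implicit.
Unset Printing Implicit Defensive.
Import Order.TTheory GRing.Theory Num.Theory.
Import numFieldNormedType.Exports.
Local Open Scope classical_set_scope.
Local Open Scope ring_scope.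
Local Open Scope ereal_scope.

(* A Borel measure on [0, +oo[ is represented by a Borel measure on the real
   line that gives no mass to ]-oo, 0[. *)
Definition concentrated_on_nonneg (R : realType)
    (mu : {measure set (measurableTypeR R) -> \bar R}) : Prop :=
  mu `]-oo, 0%R[%classic = 0.

Definition representing_measure (R : realType) (a : nat -> R)
    (mu : {measure set (measurableTypeR R) -> \bar R}) : Prop :=
  concentrated_on_nonneg mu /\
  forall n : nat, (a n)%:E = \int[mu]_(x in `[0%R, +oo[%classic) (x ^+ n)%:E.

Definition Stieltjes_moment_sequence (R : realType) (a : nat -> R) : Prop :=
  (forall n : nat, (0 <= a n)%R) /\
  exists mu : {measure set (measurableTypeR R) -> \bar R},
    representing_measure a mu.

(* For a measure concentrated on [0, +oo[ this is also its support as a measure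
   on the closed subspace [0, +oo[. *)
Definition closed_support (R : realType)
    (mu : {measure set (measurableTypeR R) -> \bar R}) : set R :=
  [set x : R | forall U : set R, open U -> U x -> 0 < mu U].

(* Supremum in the extended reals: -oo for the zero measure, +oo for an
   unbounded support. *)
Definition sup_support (R : realType)
    (mu : {measure set (measurableTypeR R) -> \bar R}) : \bar R :=
  ereal_sup [set x%:E | x in closed_support mu].

(* powR sends 0 to 0 here because the exponent is nonzero when 0 < k. *)
Definition nth_root (R : realType) (k : nat) (x : R) : R :=
  (x `^ (k%:R^-1))%R.

(* Main.v *)
Require Import Defs.
From HB Require Import structures.
From mathcomp Require Import all_boot all_order all_algebra.
From mathcomp Require Import all_classical all_reals all_analysis.
From mathcomp Require Import measurable_realfun.
From mathcomp Require Import ring lra.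
Import Order.TTheory GRing.Theory Num.Theory.
Import numFieldNormedType.Exports.
Local Open Scope classical_set_scope.
Local Open Scope ring_scope.

(** Write s n for the kappa-th root of a n.  Since s n is the n-th moment of
    nu, a n = s n ^+ kappa is the n-th moment of the kappa-th multiplicative
    convolution power of nu, the image of nu x ... x nu under the product map
    (x_1, ..., x_kappa) |-> x_1 * ... * x_kappa.  As nu lives on the compact set
    [0, gamma], this image has compact support, hence is determined by its
    moments and equals mu.  Therefore

      supp mu = { x_1 * ... * x_kappa : x_i in supp nu }

    (lemma [closed_support_power]).  The rest is elementary: supp nu lies in
    [0, alpha] U [beta, gamma], so a product of kappa points of supp nu is
    either at least beta ^ kappa, with equality only when every factor is
    beta, or at most alpha * gamma ^ (kappa - 1), with equality only when alpha
    occurs as a factor (lemma [product_set_gap]).  The hypothesis on theta_1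
    and theta_2 says that the two alternatives exclude each other, and gamma,
    being the largest point of supp nu, makes all the extreme products
    available.

    Only the supports matter, so the convolution power is never built as a
    measure and no approximation theorem is used.  A point x of a compactly
    supported measure is detected by the growth rate in n of the integral of
    p ^ (2n), where p t = D - (x - t) ^ 2, with D large, has a strict
    peak at x: the rate is D ^ 2 if x is in the support and strictly smaller
    otherwise.  Such an
    integral depends on the moments alone, so two compactly supported positive
    functionals that agree on polynomials have the same support (lemma
    [charges_carrier], applied in both directions).  On polynomials,
    integration against the kappa-th convolution power is the coefficientwise
    multiplication [hadamard s], iterated kappa times and evaluated at 1,
    because the value of [hadamard s q] at y is the nu-integral of q (y * t). *)

Set Implicit Arguments.
Unset Strict Implicit.

(** * The closed support of a Borel measure on the line *)

Section ClosedSupport.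
Variables (R : realType) (mu : {measure set (measurableTypeR R) -> \bar R}).
Local Notation S := (closed_support mu).

Lemma notin_closed_supportP x :
  ~ S x <-> exists U, [/\ open U, U x & mu U = 0%E].
Proof.
split=> [/existsNP[U /not_implyP[oU /not_implyP[Ux U0]]]|[U [oU Ux U0]] /(_ U oU Ux)].
  exists U; split=> //; apply/eqP; rewrite eq_le measure_ge0 andbT leNgt.
  exact/negP.
by rewrite U0 ltxx.
Qed.

Lemma closed_closed_support : closed S.
Proof.
rewrite -(setCK S); apply: open_closedC; rewrite openE => x /= Sx.
have [U [oU Ux U0]] := (notin_closed_supportP x).1 Sx.
apply: filterS (open_nbhs_nbhs (conj oU Ux)) => y Uy.
by apply/notin_closed_supportP; exists U.
Qed.

Lemma measurable_closed_supportC : measurable (~` S : set (measurableTypeR R)).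
Proof.
by apply: measurableC; exact: (closed_measurable closed_closed_support).
Qed.

(** Every point outside the support lies in an open null set, hence in a null
    interval with rational end points, and there are countably many of these. *)
Lemma measure_closed_supportC : mu (~` S) = 0%E.
Proof.
apply: measure_negligible; first exact: measurable_closed_supportC.
(* [F] enumerates the null intervals with rational end points. *)
pose J (q : rat * rat) : set R := `]ratr q.1, ratr q.2[%classic.
pose F k : set R := if unpickle k is Some q
  then (if mu (J q) == 0%E then J q else set0) else set0.
apply: (@negligibleS _ _ _ mu (\bigcup_k F k)); last first.
  apply: negligible_bigcup => k; rewrite /F.
  case: unpickle => [q|]; last exact: negligible_set0.
  case: eqP => [q0|_]; last exact: negligible_set0.
  by apply/negligibleP => //; exact: measurable_itv.
move=> x /notin_closed_supportP[U [oU Ux U0]].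
have /nbhs_ballP [d /= d0 dU] := open_nbhs_nbhs (conj oU Ux).
have /rat_in_itvoo[q1] : x - d < x by rewrite ltrBlDr ltrDl.
have /rat_in_itvoo[q2] : x < x + d by rewrite ltrDl.
rewrite !in_itv /= => /andP[q2l q2r] /andP[q1l q1r].
exists (pickle (q1, q2)); first exact: I.
rewrite /F pickleK.
suff -> : mu (J (q1, q2)) == 0%E by rewrite /J /= in_itv /= q1r q2l.
rewrite -measure_le0 -U0 le_measure ?inE //.
- exact: measurable_itv.
- exact: open_measurable.
move=> t; rewrite /J /= in_itv /= => /andP[t1 t2]; apply: dU.
by rewrite -ball_normE /= ltr_distlC (lt_trans q1l) // (lt_trans t2).
Qed.

Lemma measure0_support_disjoint (U : set R) :
  open U -> mu U = 0%E <-> (forall x, S x -> ~ U x).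
Proof.
move=> oU; split=> [U0 x Sx Ux|SU].
  by have := Sx U oU Ux; rewrite U0 ltxx.
apply/eqP; rewrite -measure_le0 -measure_closed_supportC le_measure ?inE //.
- exact: open_measurable.
- exact: measurable_closed_supportC.
by move=> x Ux Sx; exact: SU Ux.
Qed.

End ClosedSupport.

Lemma closed_support_le_sup (R : realType)
    (nu : {measure set (measurableTypeR R) -> \bar R}) gamma t :
  gamma%:E = sup_support nu -> closed_support nu t -> t <= gamma.
Proof. by move=> E St; rewrite -lee_fin E; apply: ereal_sup_ubound; exists t. Qed.

(** A finite supremum of the support is attained because the support is closed;
    that the support is nonempty follows from the supremum not being -oo. *)
Lemma closed_support_sup (R : realType)
    (nu : {measure set (measurableTypeR R) -> \bar R}) gamma :
  gamma%:E = sup_support nu -> closed_support nu gamma.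
Proof.
move=> E; apply: contrapT => Sg.
have /nbhs_ballP [d /= d0 dS] : nbhs gamma (~` closed_support nu).
  by apply: open_nbhs_nbhs; split=> //; exact/closed_openC/closed_closed_support.
suff : (sup_support nu <= (gamma - d)%:E)%E.
  by rewrite -E lee_fin lerBrDr gerDl leNgt d0.
apply: ge_ereal_sup => _ [t St <-]; rewrite lee_fin leNgt; apply/negP => td.
apply: (dS t) => //; rewrite -ball_normE /= ger0_norm ?subr_ge0; last first.
  exact: closed_support_le_sup E St.
by rewrite ltrBlDr -ltrBlDl.
Qed.

(** * Localizing a positive functional on polynomials *)

Lemma geometric_gap (R : realType) (A B m C : R) : 0 <= A -> A < B -> 0 < m ->
  (forall n, B ^+ n * m <= A ^+ n * C) -> False.
Proof.
move=> A0 AB m0 H.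
have B0 : 0 < B by exact: le_lt_trans A0 AB.
have C0 : 0 < C by have := H 0%N; rewrite !expr0 !mul1r; exact: lt_le_trans.
have AB1 : `|A / B| < 1.
  by rewrite ger0_norm ?divr_ge0 // ?ltW // ltr_pdivrMr // mul1r.
have /cvgrPdist_lt /(_ (m / C)) := cvg_expr AB1.
case=> [|N _ /(_ N (leqnn N))]; first exact: divr_gt0.
rewrite sub0r normrN ger0_norm ?exprn_ge0 ?divr_ge0 // ?ltW //.
rewrite expr_div_n ltr_pdivrMr ?exprn_gt0 // mulrAC ltr_pdivlMr //.
by rewrite [m * _]mulrC ltNge H.
Qed.

(** For L the integration against a finite positive measure, this says that the
    measure vanishes outside K; C is then the total mass.  It also makes sense
    for functionals that are not given as integrals. *)
Definition carried_by (R : realType) (L : {poly R} -> R) (K : set R) :=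
  exists C, forall c q, (forall z, K z -> q.[z] <= c) -> L q <= c * C.

(** For L the integration against a positive measure, this says that x is in the
    support; m is the mass of U.  Since m is chosen before q, the bound can be
    used along a sequence of polynomials. *)
Definition charges (R : realType) (L : {poly R} -> R) (x : R) :=
  forall U : set R, open U -> U x -> exists2 m, 0 < m &
    forall c q, 0 <= c -> (forall t, 0 <= q.[t]) -> (forall t, U t -> c <= q.[t]) ->
      c * m <= L q.

(** If x were at distance d > 0 from K, the powers of the square of
    p t = A + d ^ 2 - (x - t) ^ 2 would tell them apart: A is large enough for p
    to be nonnegative on K, where it is at most A, while p is at least
    B = A + d ^ 2 - (d / 2) ^ 2 > A on the ball of radius d / 2 about x.  Hence
    B ^ (2n) * m <= L (p ^ (2n)) <= A ^ (2n) * C for all n, which is absurd.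
    Even powers are used because p is negative far away from x. *)
Lemma charges_carrier (R : realType) (L : {poly R} -> R) (K : set R) (M x : R) :
  closed K -> (forall z, K z -> `|z| <= M) -> carried_by L K -> charges L x -> K x.
Proof.
move=> cK KM [C LK] Lx; apply: contrapT => nKx.
have /nbhs_ballP [d /= d0 dK] : nbhs x (~` K).
  by apply: open_nbhs_nbhs; split => //; exact: closed_openC.
have far z : K z -> d <= `|x - z|.
  by move=> Kz; rewrite leNgt; apply/negP => /dK.
have d20 : 0 < d / 2 by rewrite divr_gt0.
have [m m0 Lm] := Lx (ball x (d / 2)) (ball_open x (d / 2)) (ballxx _ d20).
pose A := (M + `|x|) ^+ 2.
pose p : {poly R} := (A + d ^+ 2)%:P - ('X - x%:P) ^+ 2.
have pE t : p.[t] = A + d ^+ 2 - (x - t) ^+ 2.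
  by rewrite /p !hornerE; ring.
pose B := A + d ^+ 2 - (d / 2) ^+ 2.
have A0 : 0 <= A by exact: sqr_ge0.
have AB : A < B by rewrite /B; nra.
apply: (@geometric_gap _ (A ^+ 2) (B ^+ 2) m C) => //; first exact: sqr_ge0.
  by rewrite ltr_pXn2r // nnegrE // (le_trans A0) // ltW.
move=> n; have B0 : 0 <= B by rewrite (le_trans A0) // ltW.
apply: (@le_trans _ _ (L ((p ^+ 2) ^+ n))).
  apply: Lm => [|t|t xt]; rewrite ?exprn_ge0 // !horner_exp ?(exprn_ge0 n (sqr_ge0 _)) //.
  suff Bp : B <= p.[t].
    rewrite lerXn2r ?nnegrE ?sqr_ge0 // lerXn2r ?nnegrE //.
    exact: le_trans Bp.
  rewrite pE lerD2l lerN2 -[leLHS]real_normK ?num_real // lerXn2r ?nnegrE ?(ltW d20) //.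
  exact: ltW.
apply: LK => z Kz; rewrite !horner_exp lerXn2r ?nnegrE ?sqr_ge0 //.
have zM : (x - z) ^+ 2 <= A.
  rewrite -real_normK ?num_real // lerXn2r ?nnegrE //.
    by rewrite addr_ge0 // (le_trans _ (KM _ Kz)).
  by rewrite (le_trans (ler_normB _ _)) // addrC lerD2r KM.
have zd : d ^+ 2 <= (x - z) ^+ 2.
  by rewrite -[leRHS]real_normK ?num_real // lerXn2r ?nnegrE ?far // ltW.
rewrite lerXn2r ?nnegrE // pE; nra.
Qed.

(** * Multiplicative convolution on polynomials *)

(** This is the Hadamard product of q with the power series of coefficients s. *)
Definition hadamard (R : realType) (s : nat -> R) (q : {poly R}) : {poly R} :=
  \poly_(i < size q) (q`_i * s i).

Lemma coef_hadamard (R : realType) (s : nat -> R) (q : {poly R}) i :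
  (hadamard s q)`_i = q`_i * s i.
Proof.
rewrite coef_poly; case: ltnP => // /(nth_default 0) ->.
by rewrite mul0r.
Qed.

Lemma iter_hadamard (R : realType) (s : nat -> R) k (q : {poly R}) :
  iter k (hadamard s) q = hadamard (fun n => s n ^+ k) q.
Proof.
apply/polyP => i; elim: k => [|k IH] /=; rewrite ?coef_hadamard ?expr0 ?mulr1 //.
by rewrite IH coef_hadamard exprSr mulrA.
Qed.

Lemma hadamardE (R : realType) (s : nat -> R) (q : {poly R}) y :
  (hadamard s q).[y] = \sum_(i < size q) (q`_i * y ^+ i) * s i.
Proof. by rewrite horner_poly; apply: eq_bigr => i _; rewrite mulrAC. Qed.

Section MomentFunctional.
Variables (R : realType) (s : nat -> R).
Variable nu : {measure set (measurableTypeR R) -> \bar R}.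
Hypothesis snu : representing_measure s nu.
Local Notation D := (`[0%R, +oo[%classic : set (measurableTypeR R)).
Local Notation S := (closed_support nu).

Let mD : measurable D. Proof. exact: measurable_itv. Qed.

Let measurable_horner (q : {poly R}) (A : set (measurableTypeR R)) :
  measurable_fun A (fun t : measurableTypeR R => (q.[t])%:E).
Proof. by apply/measurable_EFinP; exact: measurable_poly. Qed.

Lemma integrable_horner (q : {poly R}) : nu.-integrable D (fun t => (q.[t])%:E).
Proof.
have mono i : nu.-integrable D (fun t => (('X^i : {poly R}).[t])%:E).
  apply/integrableP; split; first exact: measurable_horner.
  rewrite [X in (X < _)%E](_ : _ = (s i)%:E) ?ltry // (snu.2 i).
  apply: eq_integral => t; rewrite inE /= in_itv /= andbT => t0.
  by rewrite hornerXn ger0_norm // exprn_ge0.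
rewrite (_ : (fun t => _) =
  (fun t => \sum_(i < size q) (q`_i)%:E * (('X^i : {poly R}).[t])%:E)%E).
  by apply: integrable_sum => // i _; exact: integrableZl.
apply/funext => t; rewrite horner_coef -sumEFin.
by apply: eq_bigr => i _; rewrite hornerXn.
Qed.

(** Thus [hadamard s] is multiplicative convolution with nu acting on
    polynomials, which is why its iterates stand for the convolution powers. *)
Lemma integral_hadamard (q : {poly R}) y :
  (\int[nu]_(t in D) (q.[y * t])%:E)%E = ((hadamard s q).[y])%:E.
Proof.
rewrite hadamardE -sumEFin.
rewrite (_ : (fun t => _) = (fun t =>
  \sum_(i < size q) (q`_i * y ^+ i)%:E * (('X^i : {poly R}).[t])%:E)%E); last first.
  apply/funext => t; rewrite horner_coef -sumEFin; apply: eq_bigr => i _.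
  by rewrite hornerXn exprMn mulrA.
rewrite integral_sum //; last first.
  by move=> i; apply: integrableZl => //; exact: integrable_horner.
apply: eq_bigr => i _; rewrite integralZl //; last exact: integrable_horner.
rewrite [RHS]EFinM (snu.2 i); congr (_ * _)%E.
by apply: eq_integral => t _; rewrite hornerXn.
Qed.

Lemma le_hadamard (p q : {poly R}) y :
  (forall t, S t -> p.[y * t] <= q.[y * t]) ->
  (hadamard s p).[y] <= (hadamard s q).[y].
Proof.
have itg (r : {poly R}) : nu.-integrable D (fun t => (r.[y * t])%:E).
  rewrite (_ : (fun t => _) = (fun t => ((r \Po (y *: 'X)).[t])%:E)).
    exact: integrable_horner.
  by apply/funext => t; rewrite horner_comp hornerZ hornerX.
move=> pq; rewrite -lee_fin -!integral_hadamard.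
have mS := @measurable_closed_supportC _ nu.
rewrite !(negligible_integral mS mD _ (measure_closed_supportC _)) //.
apply: le_integral.
- exact: measurableD.
- by apply: integrableS (itg p) => //; exact: measurableD.
- by apply: integrableS (itg q) => //; exact: measurableD.
by move=> t; rewrite inE => -[_ /contrapT St]; rewrite lee_fin pq.
Qed.

Lemma hadamard_le (q : {poly R}) y c :
  (forall t, S t -> q.[y * t] <= c) -> (hadamard s q).[y] <= c * s 0%N.
Proof.
move=> qc; have -> : c * s 0%N = (hadamard s c%:P).[y].
  have [->|c0] := eqVneq c 0.
    by rewrite hadamardE size_poly0 big_ord0 mul0r.
  by rewrite hadamardE size_polyC c0 big_ord1 coefC eqxx expr0 mulr1.
by apply: le_hadamard => t St; rewrite hornerC qc.
Qed.

(** Here m is the mass that nu gives to U; it is independent of q and of the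
    dilation factor y. *)
Lemma hadamard_ge (x : R) (U : set R) : S x -> open U -> U x ->
  exists2 m, 0 < m & forall (q : {poly R}) y c, 0 <= c -> (forall t, 0 <= q.[t]) ->
    (forall t, U t -> c <= q.[y * t]) -> c * m <= (hadamard s q).[y].
Proof.
move=> Sx oU Ux.
have mU : measurable (U : set (measurableTypeR R)).
  exact: open_measurable.
have mDU : measurable (D `&` U) by exact: measurableI.
have nuD : nu D = (s 0%N)%:E.
  rewrite (snu.2 0%N); under eq_integral do rewrite expr0.
  by rewrite -[RHS]/(\int[nu]_(x in D) cst 1 x)%E integral_cst // mul1e.
have finDU : nu (D `&` U) \is a fin_num.
  rewrite ge0_fin_numE // (@le_lt_trans _ _ (nu D)) ?nuD ?ltry //.
  by rewrite -nuD le_measure ?inE //; exact: subIsetl.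
have posDU : (0 < nu (D `&` U))%E.
  have mN : measurable (`]-oo, 0%R[%classic : set (measurableTypeR R)).
    exact: measurable_itv.
  rewrite -(measureU0 mDU mN snu.1).
  apply: lt_le_trans (Sx U oU Ux) _.
  rewrite le_measure ?inE //; first exact: measurableU.
  move=> t Ut; have [t0|t0] := ltP t 0; [right|left; split=> //].
    by rewrite /= in_itv.
  by rewrite /= in_itv /= t0.
exists (fine (nu (D `&` U))); first by rewrite fine_gt0 // posDU ltey_eq finDU.
move=> q y c c0 q0 qc.
rewrite -lee_fin -integral_hadamard EFinM fineK //.
have mq : measurable_fun D (fun t : measurableTypeR R => (q.[y * t])%:E).
  rewrite (_ : (fun t => _) = (fun t => ((q \Po (y *: 'X)).[t])%:E)) //.
  by apply/funext => t; rewrite horner_comp hornerZ hornerX.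
apply: (@le_trans _ _ (\int[nu]_(t in D `&` U) (q.[y * t])%:E)%E).
  rewrite -integral_cst //; apply: ge0_le_integral => //.
  - by apply: measurable_funS mq => //; exact: subIsetl.
  - by move=> t [_ Ut] /=; rewrite lee_fin qc.
apply: ge0_subset_integral => //.
by move=> t _; rewrite lee_fin.
Qed.

End MomentFunctional.

(** * The support of a multiplicative convolution power *)

Fixpoint product_set (R : realType) (A : set R) (k : nat) : set R :=
  if k is k'.+1 then [set z.1 * z.2 | z in product_set A k' `*` A] else [set 1].

Lemma product_set_exp (R : realType) (A : set R) k x : A x -> product_set A k (x ^+ k).
Proof.
move=> Ax; elim: k => //= k IH.
by exists (x ^+ k, x) => //; rewrite exprSr.
Qed.

Lemma compact_product_set (R : realType) (A : set R) k :
  compact A -> compact (product_set A k).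
Proof.
move=> cA; elim: k => [|k IH] /=; first exact: compact_set1.
apply: continuous_compact; last exact: compact_setX.
exact/continuous_subspaceT/mul_continuous.
Qed.

Section SupportOfPower.
Variables (R : realType) (s : nat -> R).
Variable nu : {measure set (measurableTypeR R) -> \bar R}.
Hypothesis snu : representing_measure s nu.
Local Notation S := (closed_support nu).

(** The k-th convolution power is carried by the k-fold products of points of
    the support, and its total mass is the k-th power of that of nu. *)
Lemma iter_hadamard_le k (q : {poly R}) y c :
  (forall z, product_set S k z -> q.[y * z] <= c) ->
  (iter k (hadamard s) q).[y] <= c * s 0%N ^+ k.
Proof.
elim: k y c => [|k IH] y c qc /=; first by rewrite mulr1 -[y]mulr1 qc.
rewrite exprSr mulrA; apply: (hadamard_le snu) => t St.
apply: IH => z Pz; rewrite -mulrA [t * z]mulrC; apply: qc.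
by exists (z, t).
Qed.

Lemma hadamard_ge0 (q : {poly R}) : (forall t, 0 <= q.[t]) ->
  forall t, 0 <= (hadamard s q).[t].
Proof.
move=> q0 t; have <- : (hadamard s 0).[t] = 0.
  by rewrite hadamardE size_poly0 big_ord0.
by apply: (le_hadamard snu) => u _; rewrite horner0.
Qed.

(** Conversely the k-th convolution power charges each such product.  The bound is
    required for all v near y so that the induction goes through: in
    the inductive step the last factor t varies in a neighbourhood, on which
    the remaining k factors are dilated by v * t instead of y * t. *)
Lemma iter_hadamard_ge k x : product_set S k x -> forall y W, open W -> W (y * x) ->
  exists2 m, 0 < m & \forall v \near y, forall (q : {poly R}) c,
    0 <= c -> (forall t, 0 <= q.[t]) -> (forall t, W t -> c <= q.[t]) ->
    c * m <= (iter k (hadamard s) q).[v].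
Proof.
elim: k x => [|k IH] x /=.
  move=> -> y W oW; rewrite mulr1 => Wy; exists 1 => //.
  apply: filterS (open_nbhs_nbhs (conj oW Wy)) => v Wv q c _ _ qc.
  by rewrite mulr1 qc.
move=> [[u t] /= [Pu St] <-] y W oW; rewrite [u * t]mulrC mulrA => Wyx.
have [m m0 Hm] := IH u Pu (y * t) W oW Wyx.
have [[V T] /= [Vy Tt] VT] := @mul_continuous R (y, t) _ Hm.
have [m' m'0 Hm'] := hadamard_ge snu St (open_interior T) Tt.
exists (m * m'); first exact: mulr_gt0.
apply: filterS Vy => v Vv q c c0 q0 qc; rewrite mulrA.
apply: Hm' => [|w|w Tw].
- by rewrite mulr_ge0 // ltW.
- by elim: (k) w => //= j; exact: hadamard_ge0.
by apply: (VT (v, w)) => //; split => //; exact: interior_subset.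
Qed.

(** The functional L can be read as integration against mu or as the k-th
    convolution power of nu, so it is carried by, and charges, both the support
    of mu and the set of products.  The inclusion of supp mu in the set of
    products comes first, as it gives the boundedness of supp mu that the
    converse inclusion needs. *)
Lemma closed_support_power k (mu : {measure set (measurableTypeR R) -> \bar R}) :
  compact S -> representing_measure (fun n => s n ^+ k) mu ->
  closed_support mu = product_set S k.
Proof.
move=> cS amu; pose P := product_set S k.
have cP : compact P by exact: compact_product_set.
have clP : closed P by exact: compact_closed.
have [M [_ MP]] := compact_bounded cP.
have PM z : P z -> `|z| <= M + 1 by apply: MP; rewrite ltrDl.
pose L (q : {poly R}) := (hadamard (fun n => s n ^+ k) q).[1].
have LP : carried_by L P.
  exists (s 0%N ^+ k) => c q qc; rewrite /L -iter_hadamard.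
  by apply: iter_hadamard_le => z Pz; rewrite mul1r qc.
have Lmu : carried_by L (closed_support mu).
  exists (s 0%N ^+ k) => c q qc.
  by apply: (hadamard_le amu) => z Pz; rewrite mul1r qc.
have sub : closed_support mu `<=` P.
  move=> x mux; apply: (charges_carrier clP PM LP) => U oU Ux.
  have [m m0 H] := hadamard_ge amu mux oU Ux.
  by exists m => // c q c0 q0 qc; apply: H => // t Ut; rewrite mul1r qc.
apply/seteqP; split=> // x Px.
have muM z : closed_support mu z -> `|z| <= M + 1 by move=> /sub/PM.
apply: (charges_carrier (@closed_closed_support _ mu) muM Lmu) => U oU Ux.
have U1x : U (1 * x) by rewrite mul1r.
have [m m0 /nbhs_singleton H] := iter_hadamard_ge Px oU U1x.
by exists m => // c q c0 q0 qc; rewrite /L -iter_hadamard; exact: H.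
Qed.

End SupportOfPower.

(** * Products of points avoiding a gap *)

(** If some factor is at most alpha, bounding the others by gamma shows that the
    product is at most alpha * gamma ^ k, and equality forces that factor to be
    alpha because gamma is positive.  Otherwise all factors are at least beta,
    and equality in the resulting bound forces them all to be beta. *)
Lemma product_set_gap (R : realType) (A : set R) (alpha beta gamma : R) k z :
  0 <= alpha -> alpha < beta -> beta <= gamma ->
  (forall t, A t -> 0 <= t <= gamma) -> (forall t, A t -> t <= alpha \/ beta <= t) ->
  product_set A k.+1 z ->
  0 <= z <= gamma ^+ k.+1 /\
  ((beta ^+ k.+1 <= z /\ (z = beta ^+ k.+1 -> A beta)) \/
   (z <= alpha * gamma ^+ k /\ (z = alpha * gamma ^+ k -> A alpha))).
Proof.
move=> a0 ab bg A0 Agap.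
have b0 : 0 < beta by exact: le_lt_trans ab.
have g0 : 0 < gamma by exact: lt_le_trans bg.
have gk0 j : 0 < gamma ^+ j by rewrite exprn_gt0.
have bk0 j : 0 < beta ^+ j by rewrite exprn_gt0.
elim: k z => [|k IH] z.
  move=> [[_ t] /= [-> At] <-]; rewrite mul1r !expr1 expr0 mulr1; split; first exact: A0.
  by have [ta|bt] := Agap t At; [right|left]; split=> // <-.
move=> [[y t] /= [Py At] <-].
have [/andP[y0 yg] IHy] := IH y Py; have /andP[t0 tg] := A0 t At.
split; first by rewrite mulr_ge0 //= exprSr ler_pM.
have [ta|bt] := Agap t At.
  right; split; first by rewrite mulrC ler_pM.
  move=> E; suff <- : t = alpha by [].
  apply/eqP; rewrite eq_le ta /= -(ler_pM2r (gk0 k.+1)) -E mulrC.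
  by rewrite ler_wpM2l.
case: IHy => -[yb yE]; [left|right]; split.
- by rewrite exprSr ler_pM // ltW.
- rewrite exprSr => E; suff <- : t = beta by [].
  apply/eqP; rewrite eq_le bt andbT -(ler_pM2l (bk0 k.+1)) -E.
  by rewrite ler_wpM2r.
- by rewrite exprSr mulrA ler_pM.
rewrite exprSr mulrA => E; apply: yE; apply/eqP; rewrite eq_le yb /=.
by rewrite -(ler_pM2r g0) -E ler_wpM2l.
Qed.

Lemma nth_root_exp (R : realType) k (x : R) :
  (0 < k)%N -> 0 <= x -> nth_root k x ^+ k = x.
Proof.
move=> k0 x0; rewrite /nth_root -powR_mulrn ?powR_ge0 // -powRrM mulVf ?powRr1 //.
by rewrite pnatr_eq0 -lt0n.
Qed.

Unset Implicit Arguments.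

Theorem theorem5p1 (R : realType) (kappa : nat) (hkappa : (2 <= kappa)%N)
  (a : nat -> R) (mu nu : {measure set (measurableTypeR R) -> \bar R})
  (ha : Stieltjes_moment_sequence a)
  (hmu : representing_measure a mu)
  (hroot : Stieltjes_moment_sequence (fun n => nth_root kappa (a n)))
  (hnu : representing_measure (fun n => nth_root kappa (a n)) nu)
  (alpha beta gamma : R)
  (hnu0 : nu `]alpha, beta[%classic = 0%E)
  (hgamma : gamma%:E = sup_support nu)
  (halpha : 0 <= alpha) (halphabeta : alpha < beta) (hbeta : beta <= gamma)
  (hgap : alpha * gamma ^+ (kappa - 1) < beta ^+ kappa) :
  let theta1 := alpha * gamma ^+ (kappa - 1) in
  let theta2 := beta ^+ kappa in
  let theta3 := gamma ^+ kappa in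
  [/\ mu `]theta1, theta2[%classic = 0%E
        /\ (theta3%:E = sup_support mu /\ (sup_support mu < +oo)%E),
      closed_support nu alpha <-> closed_support mu theta1 &
      closed_support nu beta <-> closed_support mu theta2].
Proof.
case: kappa hkappa hroot hnu hgap => // k _ _ hnu.
rewrite subSS subn0 => hgap theta1 theta2 theta3.
have S_bounds t : closed_support nu t -> 0 <= t <= gamma.
  move=> St; rewrite (closed_support_le_sup hgamma St) andbT leNgt; apply/negP => t0.
  have o0 : open (`]-oo, 0%R[%classic : set R) by [].
  apply: ((measure0_support_disjoint nu o0).1 hnu.1 t St).
  by rewrite /= in_itv.
have S_gap t : closed_support nu t -> t <= alpha \/ beta <= t.
  have oab : open (`]alpha, beta[%classic : set R) by [].
  move=> St; have := (measure0_support_disjoint nu oab).1 hnu0 t St.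
  by rewrite /= in_itv /= => /negP; rewrite negb_and -!leNgt => /orP.
have cS : compact (closed_support nu).
  apply: subclosed_compact (@segment_compact R 0 gamma) _.
    exact: closed_closed_support.
  by move=> t /S_bounds; rewrite /= in_itv.
have aE : a = (fun n => nth_root k.+1 (a n) ^+ k.+1).
  by apply/funext => n; rewrite nth_root_exp // ha.1.
have supp_mu : closed_support mu = product_set (closed_support nu) k.+1.
  by apply: (closed_support_power hnu cS); rewrite -aE.
have Sgamma := closed_support_sup hgamma.
have mu_gap z : closed_support mu z -> 0 <= z <= theta3 /\
    ((theta2 <= z /\ (z = theta2 -> closed_support nu beta)) \/
     (z <= theta1 /\ (z = theta1 -> closed_support nu alpha))).
  by rewrite supp_mu; exact: (product_set_gap halpha halphabeta hbeta).
have sup_mu : theta3%:E = sup_support mu.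
  apply/eqP; rewrite eq_le; apply/andP; split.
    apply: ereal_sup_ubound; exists theta3 => //.
    by rewrite supp_mu; exact: product_set_exp.
  apply: ge_ereal_sup => _ [z /mu_gap[/andP[_ zg] _] <-].
  by rewrite lee_fin.
split.
- split; last by rewrite -sup_mu ltry.
  have o12 : open (`]theta1, theta2[%classic : set R) by [].
  apply/(measure0_support_disjoint mu o12) => z /mu_gap[_ zgap].
  rewrite /= in_itv /= => /andP[z1 z2].
  by case: zgap => -[]; rewrite leNgt ?z1 ?z2.
- split=> [Sa|/mu_gap[_ [[]|[_]]]]; last exact.
    rewrite supp_mu /=; exists (gamma ^+ k, alpha); last by rewrite /= mulrC.
    by split=> //; exact: product_set_exp.
  by rewrite leNgt hgap.
split=> [Sb|/mu_gap[_ [[_]|[]]]]; last 2 first.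
- exact.
- by rewrite leNgt hgap.
by rewrite supp_mu; exact: product_set_exp.
Qed.
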